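(* Let $(g_k)_{k\in K}$ be a frame for the separable Hilbert space $\mathcal{H}$, and let $(e_l)_{l\in L}$ be an orthonormal basis for $\mathcal{H}$. Then the following statements are equivalent: (1) $\sum_{k\in K}\|g_k\|^2<\infty$; (2) $\sum_{l\in L}\|e_l\|^2<\infty$; (3) $\mathcal{H}$ is finite dimensional.
   Context: A sequence $(g_k)_{k\in K}$ (with $K$ a countable, finite or infinite, index set) in a separable Hilbert space $\mathcal{H}$ is called a frame for $\mathcal{H}$ if there exist constants $A,B>0$ such that $A\|f\|^2\le\sum_{k\in K}|\langle f,g_k\rangle|^2\le B\|f\|^2$ for all $f\in\mathcal{H}$. Frames may be infinite even if $\mathcal{H}$ is finite dimensional. ''Orthonormal basis'' means Hilbert space orthonormal basis (complete orthonormal system). *)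

(* Defs.v *)
From HB Require Import structures.
From mathcomp Require Import all_boot all_order all_algebra.
From mathcomp Require Import finmap complex.
From mathcomp Require Import boolp classical_sets functions cardinality fsbigop.
From mathcomp Require Import reals ereal topology normedtype sequences esum.

Set Implicit Arguments.
Unset Strict Implicit.
Unset Printing Implicit Defensive.

Import Order.TTheory GRing.Theory Num.Theory.
Import numFieldNormedType.Exports.

Local Open Scope classical_set_scope.
Local Open Scope ring_scope.

Variant scalar_kind := RealScalars | ComplexScalars.

Definition scalars (R : realType) (s : scalar_kind) : numFieldType :=
  match s with
  | RealScalars => R
  | ComplexScalars => R[i]
  end.

Definition scalar_conj (R : realType) (s : scalar_kind) :
    {rmorphism scalars R s -> scalars R s} :=
  match s with
  | RealScalars => (idfun : {rmorphism R -> R})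
  | ComplexScalars => (@conjc R : {rmorphism R[i] -> R[i]})
  end.

(* The library's norm of a [normedModType K] takes its values in [K], also for
   K = R[i]; this sends such a value (a real scalar) back to [R]. *)
Definition real_part (R : realType) (s : scalar_kind) : scalars R s -> R :=
  match s return scalars R s -> R with
  | RealScalars => fun x => x
  | ComplexScalars => @complex.Re R
  end.

Section HilbertSpaces.
Variables (R : realType) (s : scalar_kind).
Local Notation K := (scalars R s).

Definition separable (T : topologicalType) : Prop :=
  exists D : set T, countable D /\ dense D.

(* [ip] is linear in its first argument and conjugate-linear in its second.
   A Hilbert space is a complete normed module with such a compatible [ip]. *)
Definition norm_induced_by (H : normedModType K)
    (ip : {dot H for scalar_conj R s}) : Prop :=
  forall x : H, `|x| ^+ 2 = ip x x.

Definition frame (H : normedModType K) (ip : {dot H for scalar_conj R s})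
    (I : countType) (g : I -> H) : Prop :=
  exists A B : R, [/\ 0 < A, 0 < B &
    forall f : H,
      ((A * real_part `|f| ^+ 2)%:E
         <= \esum_(k in [set: I]) (real_part `|ip f (g k)| ^+ 2)%:E)%E /\
      (\esum_(k in [set: I]) (real_part `|ip f (g k)| ^+ 2)%:E
         <= (B * real_part `|f| ^+ 2)%:E)%E].

Definition family_span (V : lmodType K) (L : choiceType) (e : L -> V) : set V :=
  [set x | exists (F : {fset L}) (c : L -> K), x = \sum_(l <- F) c l *: e l].

Definition orthonormal_basis (H : normedModType K)
    (ip : {dot H for scalar_conj R s}) (L : choiceType) (e : L -> H) : Prop :=
  (forall l l' : L, ip (e l) (e l') = (l == l')%:R) /\
  dense (family_span e).

Definition square_summable (H : normedModType K) (I : choiceType)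
    (h : I -> H) : Prop :=
  (\esum_(k in [set: I]) (real_part `|h k| ^+ 2)%:E < +oo)%E.

(* [Vector.axiom n H]: a linear bijection from [H] onto row vectors K^n. *)
Definition finite_dimensional (V : lmodType K) : Prop :=
  exists n : nat, inhabited (Vector.axiom n V).

End HilbertSpaces.

(* Main.v *)
Require Import Defs.
From HB Require Import structures.
From mathcomp Require Import all_boot all_order all_algebra.
From mathcomp Require Import boolp classical_sets reals topology normedtype.
From mathcomp Require Import finmap complex cardinality fsbigop ereal esum.

(** Every member of an orthonormal basis has norm 1, so the sum in (2) counts
    the basis. The three statements therefore all say that the index set [L]
    is finite.

    For (1), the idea is that the double family |<e_l, g_k>|^2 can be summed
    in either order ([esum_coordinates]). Summing over [k] first, the frame
    inequalities at the unit vector [e_l] place each inner sum between [A] and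
    [B]. Summing over [l] first, each inner sum is compared with |g_k|^2.
    - If (1) holds, Bessel's inequality bounds the double sum over any [n]
      indices [l] by S, the sum of the |g_k|^2, so [n * A <= S]. Thus [L] has
      at most S / A elements.
    - If [L] is finite, Parseval's identity makes the double sum equal to the
      sum of the |g_k|^2, which is then at most #|L| * B.

    For (3), when [L] is finite the difference between a vector and its
    Fourier sum is orthogonal to the dense span of the basis, hence is 0, and
    the Fourier coefficients give a linear bijection onto K^n. Conversely
    orthonormal vectors are linearly independent, so a space of dimension [n]
    contains at most [n] of them. *)

Set Implicit Arguments.
Unset Strict Implicit.
Unset Printing Implicit Defensive.

Import Order.TTheory GRing.Theory Num.Theory.
Import numFieldNormedType.Exports.

Local Open Scope classical_set_scope.
Local Open Scope ring_scope.

(** * Real and complex scalars *)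

Section Scalars.
Variables (R : realType) (s : scalar_kind).
Local Notation K := (scalars R s).

Lemma real_partD (x y : K) : real_part (x + y) = real_part x + real_part y.
Proof. by case: s x y => //= -[a b] [c d]. Qed.

Lemma real_part1 : real_part (1 : K) = 1.
Proof. by case: s. Qed.

Lemma real_part0 : real_part (0 : K) = 0.
Proof. by case: s. Qed.

Lemma real_part_sum (T : Type) (r : seq T) (F : T -> K) :
  real_part (\sum_(i <- r) F i) = \sum_(i <- r) real_part (F i).
Proof. exact: (big_morph _ real_partD real_part0). Qed.

Lemma real_part_ge0 (x : K) : 0 <= x -> 0 <= real_part x.
Proof. by case: s x => //= -[a b]; rewrite lecE => /andP[]. Qed.

Lemma real_partX2 (x : K) : 0 <= x -> real_part (x ^+ 2) = real_part x ^+ 2.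
Proof.
case: s x => //= -[a b]; rewrite lecE => /andP[/eqP/= -> _].
by rewrite !expr2 /= mulr0 subr0.
Qed.

Lemma sqr_norm_scalar (z : K) : `|z| ^+ 2 = z * scalar_conj R s z.
Proof.
case: s z => /= z; last by rewrite -sqr_normc.
by rewrite real_normK ?num_real// expr2.
Qed.

Lemma norm_scalar_conj (z : K) : `|scalar_conj R s z| = `|z|.
Proof. by case: s z => //= z; rewrite normcJ. Qed.

End Scalars.

(** * Finiteness of an index set from a bound on its finite parts *)

Lemma finite_set_bounded_size (R : realType) (L : choiceType) (M : R) :
  (forall r : seq L, uniq r -> (size r)%:R <= M) -> finite_set [set: L].
Proof.
move=> rM; apply: contrapT => /(infinite_set_fset (Num.truncn M).+1)[F _ F_gt].
have := rM F (fset_uniq F); apply/negP; rewrite -ltNge.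
by rewrite (lt_le_trans (truncnS_gt M))// ler_nat.
Qed.

Lemma finite_enumeration (L : choiceType) : finite_set [set: L] ->
  exists2 r : seq L, uniq r & forall l, l \in r.
Proof.
move=> fL; exists (fset_set [set: L]); first exact: fset_uniq.
by move=> l; rewrite in_fset_set// in_setT.
Qed.

(** * Orthonormal families *)

Section Hilbert.
Variables (R : realType) (s : scalar_kind) (H : normedModType (scalars R s)).
Variable ip : {dot H for scalar_conj R s}.
Hypothesis H_hilbert : norm_induced_by ip.
Local Notation K := (scalars R s).
Local Notation conj := (scalar_conj R s).

Lemma ipC x y : ip x y = conj (ip y x).
Proof. by rewrite hermC expr0 mul1r. Qed.

Lemma norm_ipC x y : `|ip x y| = `|ip y x|.
Proof. by rewrite ipC norm_scalar_conj. Qed.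

Lemma ip_suml (T : Type) (r : seq T) (c : T -> K) (f : T -> H) y :
  ip (\sum_(i <- r) c i *: f i) y = \sum_(i <- r) c i * ip (f i) y.
Proof. by rewrite linear_sumlz; apply: eq_bigr => i _; rewrite linearZl_LR. Qed.

Lemma sqr_normD_orth x y : ip x y = 0 -> `|x + y| ^+ 2 = `|x| ^+ 2 + `|y| ^+ 2.
Proof. by move=> xy0; rewrite !H_hilbert hnormDd. Qed.

Section Orthonormal.
Variables (L : choiceType) (e : L -> H).
Hypothesis e_orth : forall l m, ip (e l) (e m) = (l == m)%:R.

Lemma ip_orthonormal_sum (r : seq L) (c : L -> K) m : uniq r ->
  ip (\sum_(l <- r) c l *: e l) (e m) = if m \in r then c m else 0.
Proof.
move=> r_uniq; rewrite ip_suml.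
under eq_bigr => l _ do rewrite e_orth mulr_natr mulrb.
rewrite -big_mkcond; case: ifP => mr.
  by rewrite -big_filter filter_pred1_uniq// big_seq1.
rewrite big_seq_cond big1// => l /andP[lr /eqP lm].
by rewrite -lm lr in mr.
Qed.

Lemma ip_orthonormal_tnth n (t : n.-tuple L) (c : 'I_n -> K) j : uniq t ->
  ip (\sum_i c i *: e (tnth t i)) (e (tnth t j)) = c j.
Proof.
move=> /tuple_uniqP t_inj; rewrite ip_suml (bigD1 j)//= e_orth eqxx mulr1.
rewrite big1 ?addr0// => i ij.
by rewrite e_orth (inj_eq t_inj) (negbTE ij) mulr0.
Qed.

Definition fourier_sum (r : seq L) (x : H) : H :=
  \sum_(l <- r) ip x (e l) *: e l.

Lemma ip_fourier_residual r x m : uniq r -> m \in r ->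
  ip (x - fourier_sum r x) (e m) = 0.
Proof.
by move=> r_uniq mr; rewrite linearBl /= ip_orthonormal_sum// mr subrr.
Qed.

(** The residual [x - fourier_sum r x] is orthogonal to each [e l] with
    [l \in r], hence to the Fourier sum itself. *)
Lemma pythagoras r x : uniq r ->
  `|x| ^+ 2 = \sum_(l <- r) `|ip x (e l)| ^+ 2 + `|x - fourier_sum r x| ^+ 2.
Proof.
move=> r_uniq; rewrite -{1}(subrK (fourier_sum r x) x) addrC.
rewrite sqr_normD_orth; last first.
  rewrite ip_suml big_seq big1// => l lr.
  by rewrite [ip (e l) _]ipC ip_fourier_residual// rmorph0 mulr0.
congr (_ + _); rewrite H_hilbert ip_suml; apply: eq_big_seq => l lr.
by rewrite [ip (e l) _]ipC ip_orthonormal_sum// lr sqr_norm_scalar.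
Qed.

(** [pythagoras] is an identity between elements of [K], while frames and
    square summability are stated with real sums; this form connects the two.
    Dropping the last term gives Bessel's inequality; when the residual
    vanishes, this is Parseval's identity. *)
Lemma parseval_residual r x : uniq r ->
  real_part `|x| ^+ 2 = \sum_(l <- r) real_part `|ip x (e l)| ^+ 2
                        + real_part `|x - fourier_sum r x| ^+ 2.
Proof.
move=> r_uniq; rewrite -real_partX2// (pythagoras x r_uniq) real_partD.
rewrite real_part_sum real_partX2//; congr (_ + _).
by apply: eq_bigr => l _; rewrite real_partX2.
Qed.

Lemma bessel r x : uniq r ->
  \sum_(l <- r) real_part `|ip x (e l)| ^+ 2 <= real_part `|x| ^+ 2.
Proof. by move=> r_uniq; rewrite (parseval_residual x r_uniq) lerDl sqr_ge0. Qed.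

Lemma orthonormal_norm1 l : real_part `|e l| = 1.
Proof.
have e1 : `|e l| ^+ 2 = 1 by rewrite H_hilbert e_orth eqxx.
apply/eqP; rewrite -(@eqrXn2 _ 2)//; last exact: real_part_ge0.
by rewrite -real_partX2// e1 real_part1 expr1n.
Qed.

(** For [z] in the span, orthogonality gives |y - z|^2 = |y|^2 + |z|^2, so [z]
    is at distance at least |y| from [y]. If [y] were nonzero, the open ball of
    center [y] and radius |y| would miss the dense span. *)
Lemma orthogonal_dense_eq0 y :
  dense (family_span e) -> (forall l, ip y (e l) = 0) -> y = 0.
Proof.
move=> e_dense y_orth; apply/eqP/negPn/negP => y0.
have ny : 0 < `|y| by rewrite normr_gt0.
have [||z [yz [F [c zE]]]] := e_dense (ball y `|y|).
- by exists y; exact: ballxx.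
- exact: ball_open.
have yz0 : ip y (- z) = 0.
  rewrite linearNr /= ipC zE ip_suml big1 ?rmorph0 ?oppr0// => l _.
  by rewrite ipC y_orth rmorph0 mulr0.
move: yz; rewrite -ball_normE /=.
rewrite -(@ltr_pXn2r _ 2) ?nnegrE// sqr_normD_orth//.
by rewrite normrN gtrDl le_gtF ?exprn_ge0.
Qed.

(** The coordinate rows of orthonormal vectors are linearly independent: a
    relation between them is a relation between the vectors, and its inner
    product with the [j]-th vector is its [j]-th coefficient. *)
Lemma orthonormal_size n (r : seq L) :
  Vector.axiom n H -> uniq r -> (size r <= n)%N.
Proof.
move=> [v vlin /bij_inj vinj] r_uniq.
pose vl : {linear H -> 'rV[K]_n} :=
  HB.pack v (GRing.isLinear.Build _ _ _ _ v vlin).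
pose t := in_tuple r.
pose A : 'M[K]_(size r, n) := \matrix_(i < size r) v (e (tnth t i)).
suff : row_free A.
  by rewrite -row_leq_rank => /leq_trans; apply; exact: rank_leq_col.
rewrite -kermx_eq0; apply/rowV0P => u /sub_kermxP.
rewrite mulmx_sum_row => uA0; apply/rowP => j; rewrite mxE.
have u0 : \sum_i u 0 i *: e (tnth t i) = 0.
  apply: vinj; rewrite -[v]/(vl : _ -> _) linear0 linear_sum -[RHS]uA0.
  by apply: eq_bigr => i _; rewrite linearZ rowK.
have := congr1 (fun x => ip x (e (tnth t j))) u0.
by rewrite linear0l ip_orthonormal_tnth.
Qed.

(** All terms are 1, so a finite value of the sum bounds the size of every
    finite part of [L]. *)
Lemma square_summable_finite : square_summable e <-> finite_set [set: L].
Proof.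
rewrite /square_summable; under eq_esum do rewrite orthonormal_norm1 expr1n.
split=> [|fL]; last first.
  rewrite esum_fset// (fsbig_finite _ _ fL).
  by rewrite sumEFin ltry.
move=> Soo; have S0 : (0 <= \esum_(l in [set: L]) 1%:E :> \bar R)%E.
  by apply: esum_ge0 => *; rewrite lee_fin.
pose S := fine (\esum_(l in [set: L]) 1%:E : \bar R).
apply: (@finite_set_bounded_size R L S) => r r_uniq.
rewrite -lee_fin fineK ?ge0_fin_numE//.
apply: esum_ge; exists [set` r]; first by split=> //; exact: finite_seq.
rewrite -fsbig_seq// sumEFin lee_fin.
by rewrite big_const_seq count_predT iter_addr addr0.
Qed.

(** * Finite orthonormal bases *)

Section Complete.
Variable r : seq L.
Hypotheses (r_uniq : uniq r) (r_full : forall l, l \in r).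
Hypothesis e_dense : dense (family_span e).

Lemma orthonormal_expansion x : fourier_sum r x = x.
Proof.
apply/esym/subr0_eq/orthogonal_dense_eq0 => // l.
exact: ip_fourier_residual.
Qed.

Lemma parseval x :
  real_part `|x| ^+ 2 = \sum_(l <- r) real_part `|ip x (e l)| ^+ 2.
Proof.
rewrite (parseval_residual x r_uniq) orthonormal_expansion subrr normr0.
by rewrite real_part0 expr0n addr0.
Qed.

Lemma finite_basis_finite_dimensional : finite_dimensional H.
Proof.
pose t := in_tuple r.
exists (size r); constructor; exists (fun x => \row_i ip x (e (tnth t i))).
  by move=> a x y; apply/rowP => i; rewrite !mxE linearPl.
exists (fun u : 'rV_(size r) => \sum_i u 0 i *: e (tnth t i)) => [x|u].
  rewrite /= -[RHS]orthonormal_expansion /fourier_sum [RHS]big_tnth.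
  by apply: eq_bigr => i _; rewrite mxE.
by apply/rowP => j; rewrite mxE ip_orthonormal_tnth.
Qed.

End Complete.

(** * Frames against an orthonormal family *)

(** Both sides are sums of |<e_l, g_k>|^2 over pairs; the exchange is
    legitimate because the terms are nonnegative. *)
Lemma esum_coordinates (I : choiceType) (g : I -> H) (r : seq L) :
  (\sum_(l <- r) \esum_(k in [set: I]) (real_part `|ip (e l) (g k)| ^+ 2)%:E
   = \esum_(k in [set: I])
       (\sum_(l <- r) real_part `|ip (g k) (e l)| ^+ 2)%:E)%E.
Proof.
under eq_esum do rewrite -sumEFin.
rewrite esum_sum => [|k l _ _]; last by rewrite lee_fin sqr_ge0.
by apply: eq_bigr => l _; apply: eq_esum => k _; rewrite norm_ipC.
Qed.

(** The lower frame bound at each unit vector [e l] contributes [A], while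
    Bessel's inequality caps the total by the sum of the |g_k|^2. *)
Lemma square_summable_frame_finite (I : countType) (g : I -> H) :
  frame ip g -> square_summable g -> finite_set [set: L].
Proof.
move=> [A [B [A0 _ gAB]]] gS.
have S0 : (0 <= \esum_(k in [set: I]) (real_part `|g k| ^+ 2)%:E)%E.
  by apply: esum_ge0 => *; rewrite lee_fin sqr_ge0.
pose S := fine (\esum_(k in [set: I]) (real_part `|g k| ^+ 2)%:E)%E.
apply: (@finite_set_bounded_size R L (S / A)) => r r_uniq.
rewrite ler_pdivlMr// -lee_fin fineK ?ge0_fin_numE//.
apply: (@le_trans _ _ (\sum_(l <- r) \esum_(k in [set: I])
    (real_part `|ip (e l) (g k)| ^+ 2)%:E)%E); last first.
  by rewrite esum_coordinates; apply: le_esum => k _; rewrite lee_fin bessel.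
have -> : ((size r)%:R * A)%:E = (\sum_(l <- r) A%:E)%E.
  by rewrite sumEFin big_const_seq count_predT iter_addr addr0 mulr_natl.
apply: lee_sum => l _; have [+ _] := gAB (e l).
by rewrite orthonormal_norm1 expr1n mulr1.
Qed.

(** By Parseval's identity, the sum of the |g_k|^2 is a finite sum over [l] of
    terms that the upper frame bound at the unit vector [e l] caps by [B]. *)
Lemma finite_basis_frame_square_summable (I : countType) (g : I -> H) :
  dense (family_span e) -> finite_set [set: L] ->
  frame ip g -> square_summable g.
Proof.
move=> e_dense /finite_enumeration[r r_uniq r_full] [A [B [_ _ gAB]]].
rewrite /square_summable; under eq_esum do rewrite (parseval r_uniq)//.
rewrite -esum_coordinates.
apply: (@le_lt_trans _ _ (\sum_(l <- r) B%:E)%E); last by rewrite sumEFin ltry.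
apply: lee_sum => l _; have [_] := gAB (e l).
by rewrite orthonormal_norm1 expr1n mulr1.
Qed.

End Orthonormal.
End Hilbert.

Theorem proposition5p1 (R : realType) (s : scalar_kind)
    (H : completeNormedModType (scalars R s))
    (ip : {dot H for scalar_conj R s})
    (H_hilbert : norm_induced_by ip)
    (H_separable : separable H)
    (I : countType) (g : I -> H) (g_frame : frame ip g)
    (L : choiceType) (e : L -> H) (e_basis : orthonormal_basis ip e) :
  [<-> square_summable g; square_summable e; finite_dimensional H].
Proof.
have [e_orth e_dense] := e_basis.
have e_finite := square_summable_finite H_hilbert e_orth.
tfae.
- move=> g_sum; apply/e_finite.
  exact: (square_summable_frame_finite H_hilbert e_orth g_frame).
- move=> /e_finite/finite_enumeration[r r_uniq r_full].
  exact: (finite_basis_finite_dimensional H_hilbert e_orth r_uniq).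
- move=> [n [Hn]].
  apply: (finite_basis_frame_square_summable H_hilbert e_orth) => //.
  apply: (@finite_set_bounded_size R L n%:R) => r r_uniq.
  by rewrite ler_nat (orthonormal_size e_orth Hn).
Qed.
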